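(* Let $\mathcal{V}$ and $\mathcal{V}_j$, $j\in\mathbb{J}$ ($\mathbb{J}\subset\mathbb{Z}$), be Hilbert spaces. For each $j\in\mathbb{J}$ let $b_j$ be a symmetric bounded bilinear form on $\mathcal{V}_j\times\mathcal{V}_j$, and assume that there are constants $C_1,C_2>0$, independent of $j$, such that $$C_1\|u\|^2\le b_j(u,u)\le C_2\|u\|^2\qquad\text{for all } u\in\mathcal{V}_j,\ j\in\mathbb{J}.$$ Let $\{\Lambda_j\in\mathcal{L}(\mathcal{V},\mathcal{V}_j): j\in\mathbb{J}\}$ be a g-frame for $\mathcal{V}$ with respect to $\{\mathcal{V}_j: j\in\mathbb{J}\}$, and put $R_j=\Lambda_j^*$. Then $\{(\{\mathcal{V}_j,b_j\},R_j): j\in\mathbb{J}\}$ is a stable space splitting of $\mathcal{V}$.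
   Context: $\mathcal{L}(\mathcal{V},\mathcal{V}_j)$ is the space of bounded linear operators from $\mathcal{V}$ to $\mathcal{V}_j$. A sequence $\{\Lambda_j\in\mathcal{L}(\mathcal{V},\mathcal{V}_j)\}$ is a g-frame for $\mathcal{V}$ with respect to $\{\mathcal{V}_j\}$ if there are $A,B>0$ with $A\|f\|^2\le\sum_{j\in\mathbb{J}}\|\Lambda_jf\|^2\le B\|f\|^2$ for all $f\in\mathcal{V}$. Given bilinear forms $b_j$ on $\mathcal{V}_j\times\mathcal{V}_j$ with $b_j(u,u)\ge c_j\|u\|^2$ and $b_j(u,v)=b_j(v,u)\le c_j'\|u\|\,\|v\|$ for all $u,v\in\mathcal{V}_j$ (for some constants $c_j,c_j'>0$), and bounded operators $R_j\in\mathcal{L}(\mathcal{V}_j,\mathcal{V})$, the system $\{(\{\mathcal{V}_j,b_j\},R_j): j\in\mathbb{J}\}$ is called a stable space splitting of $\mathcal{V}$ if there are constants $C,C'>0$ such that for all $u\in\mathcal{V}$, $$C\|u\|^2\le\inf_{u=\sum_{j\in\mathbb{J}}R_ju_j}\ \sum_{j\in\mathbb{J}}b_j(u_j,u_j)\le C'\|u\|^2,$$ where the infimum is over all sequences $(u_j)_{j\in\mathbb{J}}$ with $u_j\in\mathcal{V}_j$ and $u=\sum_{j\in\mathbb{J}}R_ju_j$ (convergent in $\mathcal{V}$). *)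

(* Defs.v *)
From HB Require Import structures.
From mathcomp Require Import all_boot all_order all_algebra.
From mathcomp Require Import all_classical all_reals all_analysis.
From mathcomp Require analysis.showcase.summability.

Set Implicit Arguments.
Unset Strict Implicit.
Unset Printing Implicit Defensive.
Import Order.TTheory GRing.Theory Num.Theory.
Import numFieldNormedType.Exports.
Local Open Scope classical_set_scope.
Local Open Scope ring_scope.

HB.mixin Record NormedModule_hasInner (R : realType) V of NormedModule R V := {
  inner : {dot V for (@idfun R)};
  innerE : forall x : V, inner x x = `|x| ^+ 2
}.

(* Real Hilbert spaces: the norm, and hence the topology, of the underlying
   complete normed module is the one induced by the inner product. The scalars
   are real because the forms considered below are bilinear, symmetric and
   satisfy [c * `|u| ^+ 2 <= b u u]; over the complex numbers the identity
   [b ('i *: u) ('i *: u) = - b u u] would force the space to be trivial. *)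
#[short(type="hilbertType")]
HB.structure Definition Hilbert (R : realType) :=
  {V of NormedModule_hasInner R V & CompleteNormedModule R V}.

Section operators.
Variable R : realType.

Definition bounded_operator (V W : normedModType R) (f : V -> W) : Prop :=
  linear f /\ exists M : R, forall x, `|f x| <= M * `|x|.

(* The Hilbert space adjoint: [adjoint f w] is the vector [v] such that
   [inner (f x) w = inner x v] for all [x], which exists and is unique, by the
   Riesz representation theorem, when [f] is a bounded operator. *)
Definition adjoint (V W : hilbertType R) (f : V -> W) (w : W) : V :=
  xget 0 [set v : V | forall x : V, inner (f x) w = inner x v].

(* No absolute value is needed: replace [v] by [- v]. *)
Definition bounded_form (V : normedModType R) (b : V -> V -> R) : Prop :=
  exists2 c : R, 0 < c & forall u v, b u v <= c * `|u| * `|v|.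

Definition coercive_form (V : normedModType R) (b : V -> V -> R) : Prop :=
  exists2 c : R, 0 < c & forall u, c * `|u| ^+ 2 <= b u u.

End operators.

Section frames.
Variables (R : realType) (I : choiceType).
Variables (V : hilbertType R) (V_ : I -> hilbertType R).

Definition gframe (L : forall j, V -> V_ j) : Prop :=
  (forall j, bounded_operator (L j)) /\
  exists A B : R, [/\ 0 < A, 0 < B &
    forall f : V, ((A * `|f| ^+ 2)%:E <=
                   \esum_(j in [set: I]) (`|L j f| ^+ 2)%:E <=
                   (B * `|f| ^+ 2)%:E)%E].

(* [u] is the unconditional sum of the [S j (w j)], i.e. the limit in [V] of the
   net of the sums over finite sets of indices. *)
Definition represents (S : forall j, V_ j -> V) (w : forall j, V_ j) (u : V) :
    Prop :=
  summability.partial_sum (fun j => S j (w j)) @ summability.totally --> u.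

(* The energy of [w] may be infinite, and the infimum over the empty set of
   representations is [+oo]. *)
Definition splitting_energy (b : forall j, {symmetric V_ j})
    (S : forall j, V_ j -> V) (u : V) : \bar R :=
  ereal_inf [set \esum_(j in [set: I]) (b j (w j) (w j))%:E |
             w in [set w : forall j, V_ j | represents S w u]].

Definition stable_space_splitting (b : forall j, {symmetric V_ j})
    (S : forall j, V_ j -> V) : Prop :=
  [/\ forall j, coercive_form (b j),
      forall j, bounded_form (b j),
      forall j, bounded_operator (S j) &
      exists C C' : R, [/\ 0 < C, 0 < C' &
        forall u : V, ((C * `|u| ^+ 2)%:E <= splitting_energy b S u <=
                       (C' * `|u| ^+ 2)%:E)%E]].

End frames.

(* Main.v *)
Require Import Defs.
From mathcomp Require Import all_boot all_order all_algebra.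
From mathcomp Require Import finmap ring lra.
From mathcomp Require Import all_classical all_reals all_analysis.
From mathcomp Require Import analysis.showcase.summability.
Import Order.TTheory GRing.Theory Num.Theory.
Import numFieldNormedType.Exports.
Local Open Scope classical_set_scope.
Local Open Scope ring_scope.

(** Write [R_j] for the adjoint of [L j], and [A], [B] for the frame bounds.

    The lower estimate is the dual form of the Bessel inequality
    [\sum_j `|L j x| ^+ 2 <= B * `|x| ^+ 2]: every finite sum
    [z = \sum_(j in F) R_j w_j] satisfies
    [`|z| ^+ 2 <= B * \sum_(j in F) `|w_j| ^+ 2] (lemma [synthesis_bound]). In
    the limit, any representation of [u] has an energy of at least
    [C1 / B * `|u| ^+ 2] (lemma [represents_bound]).

    For the upper estimate it is enough to exhibit one good representation. By
    the same dual inequality applied to tails, the net of the finite sums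
    [\sum_(j in F) R_j (L j x)] is Cauchy; its limit [S x] is the frame operator.
    It is bounded and symmetric, and the lower frame bound says exactly that
    [inner (S x) x >= A * `|x| ^+ 2]. Hence [S] is onto: given [u] there is [v]
    with [S v = u], and the coefficients [w_j = L j v] represent [u] with
    [\sum_j `|w_j| ^+ 2 <= inner (S v) v = inner u v <= A^-1 * `|u| ^+ 2] (lemma
    [frame_representation]). The energy is then at most [C2 / A * `|u| ^+ 2].

    That [S] is onto, and also the Riesz representation theorem, which gives the
    adjoints their meaning, are two instances of one variational principle,
    [coercive_solvable]: for [S] symmetric, bounded and coercive and [f] a bounded
    functional, the quadratic energy [inner (S x) x - 2 * f x] has a minimizer
    [v], and its Euler equation is [inner (S v) x = f x]. *)

(** * Inner products *)

Section inner_product.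
Context {R : realType} {V : hilbertType R}.
Implicit Types (x y z : V) (a : R).

Lemma innerC x y : inner x y = inner y x.
Proof. by rewrite [LHS]hermitian_subproof expr0 mul1r. Qed.

Lemma innerDl x y z : inner (x + y) z = inner x z + inner y z.
Proof. exact: linearDl. Qed.

Lemma innerDr x y z : inner z (x + y) = inner z x + inner z y.
Proof. exact: linearDr. Qed.

Lemma innerZl a x y : inner (a *: x) y = a * inner x y.
Proof. exact: linearZl_LR. Qed.

Lemma innerZr a x y : inner x (a *: y) = a * inner x y.
Proof. by rewrite innerC innerZl innerC. Qed.

Lemma innerBl x y z : inner (x - y) z = inner x z - inner y z.
Proof. exact: linearBl. Qed.

Lemma innerBr x y z : inner z (x - y) = inner z x - inner z y.
Proof. exact: linearBr. Qed.

Lemma inner_suml (I : Type) (r : seq I) (F : I -> V) z :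
  inner (\sum_(i <- r) F i) z = \sum_(i <- r) inner (F i) z.
Proof. exact: linear_sumlz. Qed.

Lemma inner_ext x z : (forall y, inner x y = inner z y) -> x = z.
Proof.
move=> xz; apply/eqP; rewrite -subr_eq0 -normr_eq0 -sqrf_eq0 -innerE.
by rewrite innerBl xz subrr.
Qed.

Lemma normD2 x y : `|x + y| ^+ 2 = `|x| ^+ 2 + 2 * inner x y + `|y| ^+ 2.
Proof. by rewrite -!innerE innerDl !innerDr (innerC y x); ring. Qed.

Lemma normB2 x y : `|x - y| ^+ 2 = `|x| ^+ 2 - 2 * inner x y + `|y| ^+ 2.
Proof. by rewrite normD2 normrN -scaleN1r innerZr; ring. Qed.

Lemma polarization x y :
  inner x y = (`|x + y| ^+ 2 - `|x - y| ^+ 2) / 4.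
Proof. by rewrite normD2 normB2; field. Qed.

(** Expand the square of the norm of [`|y| *: x - `|x| *: y]. *)
Lemma cauchy_schwarz x y : inner x y <= `|x| * `|y|.
Proof.
have [->|x0] := eqVneq x 0; first by rewrite linear0l normr0 mul0r.
have [->|y0] := eqVneq y 0; first by rewrite linear0r normr0 mulr0.
have xy0 : 0 < `|x| * `|y| by rewrite mulr_gt0// normr_gt0.
have := sqr_ge0 `| `|y| *: x - `|x| *: y|.
rewrite normB2 !normrZ !normr_id innerZl innerZr => h.
rewrite -(ler_pM2l xy0); lra.
Qed.

(** By polarization, this reduces to the continuity of the norm. *)
Lemma cvg_inner {T : Type} {F : set_system T} {FF : Filter F}
    (f g : T -> V) x y :
  f @ F --> x -> g @ F --> y -> inner (f t) (g t) @[t --> F] --> inner x y.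
Proof.
move=> fx gy; under eq_fun do rewrite polarization.
rewrite polarization; apply: cvgMl; apply: cvgB.
  by apply: cvgM; apply: cvg_norm; apply: cvgD.
by apply: cvgM; apply: cvg_norm; apply: cvgB.
Qed.

End inner_product.

(** * Bounded operators *)

Section bounded_operators.
Context {R : realType} {V W : normedModType R} {f : V -> W}.
Hypothesis fP : bounded_operator f.

Lemma bounded_operatorD x y : f (x + y) = f x + f y.
Proof. by case: fP => fl _; have := fl 1 x y; rewrite !scale1r. Qed.

Lemma bounded_operatorZ a x : f (a *: x) = a *: f x.
Proof.
case: fP => fl _; have := fl a x 0; rewrite !addr0 => ->.
have := fl 1 0 0; rewrite !scale1r !addr0 => /esym/eqP.
by rewrite -subr_eq0 addrK => /eqP ->; rewrite addr0.
Qed.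

Lemma bounded_operatorB x y : f (x - y) = f x - f y.
Proof. by rewrite -scaleN1r bounded_operatorD bounded_operatorZ scaleN1r. Qed.

Lemma bounded_operator_gt0 : exists2 M : R, 0 < M & forall x, `|f x| <= M * `|x|.
Proof.
case: fP => _ [M fM]; exists (Num.max M 1); first by rewrite lt_max ltr01 orbT.
move=> x; apply: le_trans (fM x) _.
by rewrite ler_wpM2r// le_max lexx.
Qed.

Lemma bounded_operator_continuous : continuous f.
Proof.
have [M M0 fM] := bounded_operator_gt0.
move=> x; apply/cvgrPdist_lt => e e0; near=> y.
rewrite -bounded_operatorB; apply: le_lt_trans (fM _) _.
rewrite mulrC -ltr_pdivlMr//.
by near: y; apply: cvgr_dist_lt; rewrite ?divr_gt0//.
Unshelve. all: by end_near. Qed.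

End bounded_operators.

(** * Minimization of coercive quadratic functionals *)

Section variational_problem.
Context {R : realType} {V : hilbertType R}.
Variables (S : V -> V) (f : V -> R) (A : R).
Hypothesis S_bounded : bounded_operator S.
Hypothesis S_sym : forall x y, inner (S x) y = inner x (S y).
Hypothesis A_gt0 : 0 < A.
Hypothesis S_coercive : forall x, A * `|x| ^+ 2 <= inner (S x) x.
Hypothesis f_bounded : bounded_operator (f : V -> R^o).

Let phi x : R := inner (S x) x - 2 * f x.

Let fD x y : f (x + y) = f x + f y.
Proof. exact: (bounded_operatorD f_bounded). Qed.

Let fZ a x : f (a *: x) = a * f x.
Proof. exact: (bounded_operatorZ f_bounded). Qed.

(** The second-order expansion of the energy along a line, exact because the
    energy is quadratic. *)
Lemma energyD x y (t : R) : phi (x + t *: y) =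
  phi x + t ^+ 2 * inner (S y) y + 2 * t * (inner (S x) y - f y).
Proof.
rewrite /phi (bounded_operatorD S_bounded) fD.
rewrite (bounded_operatorZ S_bounded) fZ.
rewrite !innerDl !innerDr !innerZl !innerZr.
rewrite (S_sym y x) (innerC y (S x)).
ring.
Qed.

(** Since [f x <= M * `|x|], the energy is at least
    [A * `|x| ^+ 2 - 2 * M * `|x|]; complete the square. *)
Lemma energy_lbound : has_lbound (range phi).
Proof.
have [M M0 fM] := bounded_operator_gt0 f_bounded.
exists (- (M ^+ 2 / A)) => _ [x _ <-]; rewrite /phi.
have h1 := S_coercive x.
have h2 : f x <= M * `|x| := le_trans (ler_norm _) (fM x).
have h3 : 0 <= (A * `|x| - M) ^+ 2 / A by rewrite divr_ge0 ?sqr_ge0// ltW.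
have : (A * `|x| - M) ^+ 2 / A = A * `|x| ^+ 2 - 2 * M * `|x| + M ^+ 2 / A.
  by field; rewrite gt_eqF.
move=> h4; rewrite h4 in h3; lra.
Qed.

(** The parallelogram law for the form of [S]: two points of almost minimal
    energy are close, because their midpoint cannot do much better. *)
Lemma energy_midpoint x y : A * `|x - y| ^+ 2 <=
  2 * phi x + 2 * phi y - 4 * phi (2^-1 *: (x + y)).
Proof.
apply: le_trans (S_coercive _) _.
rewrite /phi (bounded_operatorZ S_bounded) fZ.
rewrite (bounded_operatorB S_bounded) (bounded_operatorD S_bounded).
rewrite fD.
rewrite innerZl innerZr innerBl !innerBr innerDl !innerDr.
rewrite (S_sym y x) (innerC y (S x)).
by rewrite le_eqVlt; apply/orP; left; apply/eqP; field.
Qed.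

(** The sublevel sets slightly above the infimum form a Cauchy filter by
    [energy_midpoint], and the energy is continuous at its limit. *)
Lemma energy_minimizer : exists v, forall x, phi v <= phi x.
Proof.
pose m := inf (range phi).
have hasm : has_inf (range phi).
  by split; [exists (phi 0), 0 | exact: energy_lbound].
have mphi x : m <= phi x by apply: ge_inf; [exact: hasm.2 | exists x].
pose F := filter_from [set e : R | 0 < e] (fun e => [set x | phi x <= m + e]).
have FF : ProperFilter F.
  apply: filter_from_proper.
    apply: filter_from_filter; first by exists 1 => /=.
    move=> e e' /= e0 e'0; exists (Num.min e e'); first by rewrite /= lt_min e0.
    move=> x /= xm; split; apply: le_trans xm _; rewrite lerD2l ge_min lexx//.
    by rewrite orbT.
  move=> e /= e0; have [_ [x _ <-] xm] := inf_adherent e0 hasm.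
  by exists x; exact: ltW.
have Fc : cvg F.
  apply: cauchy_cvg; apply: cauchy_exP => e e0.
  (* The midpoint inequality bounds [A * `|x - y| ^+ 2] by [4 * d] when [x] and
     [y] are within [d] of the infimum, so any [d <= A * e ^+ 2 / 4] would do. *)
  pose d := A * e ^+ 2 / 8.
  have d0 : 0 < d by rewrite !mulr_gt0// ?exprn_gt0// invr_gt0.
  have [_ [x _ <-] xm] := inf_adherent d0 hasm.
  exists x; exists d => //= y ym; rewrite -ball_normE/=.
  rewrite -(ltr_pXn2r (n := 2)) ?nnegrE ?normr_ge0 ?ltW// -(ltr_pM2l A_gt0).
  apply: le_lt_trans (energy_midpoint _ _) _.
  have := mphi (2^-1 *: (x + y)); rewrite -/m in xm.
  have -> : A * e ^+ 2 = 8 * d by rewrite /d; field.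
  change (is_true (phi y <= m + d)) in ym; lra.
exists (lim F) => x; apply: le_trans (mphi x).
have phic : phi @ F --> phi (lim F).
  rewrite /phi; apply: cvgB.
    apply: cvg_inner => //.
    exact: (cvg_comp _ _ Fc (bounded_operator_continuous S_bounded _)).
  apply: cvgMr.
  exact: (cvg_comp _ _ Fc (bounded_operator_continuous f_bounded _)).
apply/ler_addgt0Pr => e e0; apply: (cvgr_to_le phic).
by exists e.
Qed.

(** The Euler equation at a minimizer. *)
Lemma coercive_solvable : exists v, forall x, inner (S v) x = f x.
Proof.
have [v vmin] := energy_minimizer; exists v => x.
apply/eqP; rewrite -subr_eq0; apply/eqP.
set d := _ - _; set Q := inner (S x) x.
have Q0 : 0 <= Q.
  by apply: le_trans (S_coercive x); rewrite mulr_ge0 ?exprn_ge0// ltW.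
(* The quadratic polynomial [t ^+ 2 * Q + 2 * t * d] is nonnegative for all [t];
   [Q + 1] instead of [Q] avoids the case [Q = 0]. *)
have := vmin (v + (- (d / (Q + 1))) *: x).
rewrite energyD -/Q -/d => h.
have Q1 : 0 < Q + 1 by lra.
have h2 : 0 <= - (d / (Q + 1)) ^+ 2 * (Q + 2).
  have -> : - (d / (Q + 1)) ^+ 2 * (Q + 2) = (- (d / (Q + 1))) ^+ 2 * Q +
      2 * (- (d / (Q + 1))) * d by field; rewrite gt_eqF.
  lra.
have : (d / (Q + 1)) ^+ 2 <= 0.
  have Q2 : 0 < Q + 2 by lra.
  by rewrite -(pmulr_lle0 _ Q2) mulrC; lra.
have := sqr_ge0 (d / (Q + 1)) => h3 h4.
have /eqP : (d / (Q + 1)) ^+ 2 = 0 by apply/eqP; rewrite eq_le h3 h4.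
by rewrite sqrf_eq0 mulf_eq0 invr_eq0 (gt_eqF Q1) orbF => /eqP.
Qed.

End variational_problem.

(** * The Riesz representation theorem and adjoints *)

Section adjoints.
Context {R : realType}.

(** The variational principle for the identity operator. *)
Lemma riesz_representation {V : hilbertType R} (f : V -> R) :
  bounded_operator (f : V -> R^o) -> exists v, forall x, inner v x = f x.
Proof.
move=> fP; apply: (@coercive_solvable R V id f 1) => // [|x].
  by split=> //; exists 1 => x; rewrite mul1r.
by rewrite mul1r innerE.
Qed.

Variables (V W : hilbertType R) (f : V -> W).
Hypothesis fP : bounded_operator f.

Lemma adjointP x w : inner (f x) w = inner x (adjoint f w).
Proof.
have [v vP] : exists v, forall y, inner v y = inner w (f y) :> R^o.
  apply: riesz_representation; split.
    move=> a y z; rewrite bounded_operatorD// bounded_operatorZ//.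
    by rewrite innerDr innerZr.
  have [M M0 fM] := bounded_operator_gt0 fP.
  exists (`|w| * M) => y; rewrite -mulrA.
  have yM : `|w| * `|f y| <= `|w| * (M * `|y|) by rewrite ler_wpM2l.
  rewrite ler_norml; apply/andP; split; last first.
    exact: le_trans (cauchy_schwarz _ _) yM.
  rewrite lerNl; apply: le_trans yM.
  by rewrite -mulN1r -innerZl scaleN1r -(normrN w) cauchy_schwarz.
rewrite /adjoint; case: xgetP => [u _ /= uP|/(_ v) []]; first exact: uP.
by move=> y /=; rewrite innerC -vP innerC.
Qed.

Lemma adjoint_bounded : bounded_operator (adjoint f).
Proof.
split.
  move=> a u w; apply: inner_ext => x.
  rewrite innerDl innerZl -!(innerC x) -!adjointP.
  by rewrite innerDr innerZr.
have [M M0 fM] := bounded_operator_gt0 fP.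
exists M => w; have [->|aw0] := eqVneq (adjoint f w) 0.
  by rewrite normr0 mulr_ge0// ltW.
have {}aw0 : 0 < `|adjoint f w| by rewrite normr_gt0.
rewrite -(ler_pM2l aw0) -expr2 -innerE -adjointP.
apply: le_trans (cauchy_schwarz _ _) _.
by rewrite mulrA ler_wpM2r// mulrC.
Qed.

End adjoints.

(** * Sums over arbitrary index sets *)

Section unordered_sums.
Context {R : realType} {I : choiceType}.
Implicit Types (a : I -> R) (F G : {fset I}).

Lemma partial_sumE {W : zmodType} (x : I -> W) F :
  partial_sum x F = \sum_(i <- F) x i.
Proof. by rewrite /partial_sum big_seq_fsetE. Qed.

Lemma sum_fset_le_esum a F :
  ((\sum_(i <- F) a i)%:E <= \esum_(i in [set: I]) (a i)%:E)%E.
Proof.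
apply: esum_ge; exists [set` F]; first by split.
by rewrite fsbig_finite//= set_fsetK sumEFin.
Qed.

Lemma esum_le_sum_fset a (c : R) : (forall F, \sum_(i <- F) a i <= c) ->
  (\esum_(i in [set: I]) (a i)%:E <= c%:E)%E.
Proof.
move=> ac; apply: ge_ereal_sup => _ [X [Xfin _] <-].
by rewrite fsbig_finite//= sumEFin lee_fin.
Qed.

Lemma sum_fset_split {W : zmodType} (x : I -> W) F G : (F `<=` G)%fset ->
  \sum_(i <- G) x i = \sum_(i <- F) x i + \sum_(i <- (G `\` F)%fset) x i.
Proof.
move=> FG; rewrite (big_fsetID _ (mem F))/=; congr (_ + _); apply: eq_fbigl => i.
  by rewrite !inE/= andbC andb_idr//; move/fsubsetP: FG; apply.
by rewrite !inE/= andbC.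
Qed.

Lemma le_sum_fset a F G : (forall i, 0 <= a i) -> (F `<=` G)%fset ->
  \sum_(i <- F) a i <= \sum_(i <- G) a i.
Proof. by move=> a0 FG; rewrite (sum_fset_split _ _ _ FG) lerDl sumr_ge0. Qed.

(** The partial sums have a supremum; a finite set [F] whose sum comes within [e]
    of it leaves less than [e] for the rest. *)
Lemma sum_fset_tail a (K e : R) : (forall i, 0 <= a i) ->
    (forall F, \sum_(i <- F) a i <= K) -> 0 < e ->
  exists F, forall G, (F `<=` G)%fset -> \sum_(i <- (G `\` F)%fset) a i < e.
Proof.
move=> a0 aK e0.
pose E := range (fun F => \sum_(i <- F) a i).
have Esup : has_sup E.
  split; first by exists (\sum_(i <- fset0) a i), fset0.
  by exists K => _ [F _ <-].
have [_ [F _ <-] Fe] := sup_adherent e0 Esup.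
exists F => G FG.
have : \sum_(i <- G) a i <= sup E by apply: ub_le_sup; [exact: Esup.2|exists G].
rewrite (sum_fset_split _ _ _ FG); lra.
Qed.

End unordered_sums.

#[local] Existing Instance totally_filter.

(** * Synthesis and the frame operator *)

Section bessel_families.
Context {R : realType} {I : choiceType} {V : hilbertType R}.
Variables (V_ : I -> hilbertType R) (L : forall j, V -> V_ j) (B : R).
Hypothesis L_bounded : forall j, bounded_operator (L j).
Hypothesis B_gt0 : 0 < B.
Hypothesis bessel : forall (F : {fset I}) x,
  \sum_(j <- F) `|L j x| ^+ 2 <= B * `|x| ^+ 2.
Implicit Types (F : {fset I}) (w : forall j, V_ j).

Local Notation synthesis w :=
  (partial_sum (fun j => adjoint (L j) (w j))).

Lemma inner_synthesis w F x :
  inner (synthesis w F) x = \sum_(j <- F) inner (w j) (L j x).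
Proof.
rewrite partial_sumE inner_suml; apply: eq_bigr => j _.
by rewrite innerC -adjointP// innerC.
Qed.

(** With [z] the synthesized vector, [`|z| ^+ 2] is the sum of the
    [inner (w j) (L j z)]. Young's inequality with weight [B] bounds it by half of
    [B * \sum_j `|w j| ^+ 2 + B^-1 * \sum_j `|L j z| ^+ 2], whose second term is
    at most [`|z| ^+ 2] and can be absorbed. *)
Lemma synthesis_bound w F :
  `|synthesis w F| ^+ 2 <= B * \sum_(j <- F) `|w j| ^+ 2.
Proof.
set z := synthesis w F.
have young j : 2 * inner (w j) (L j z) <= B * `|w j| ^+ 2 + B^-1 * `|L j z| ^+ 2.
  have := sqr_ge0 `|B *: w j - L j z|.
  rewrite normB2 normrZ innerZl gtr0_norm// => h.
  rewrite -(ler_pM2l B_gt0) mulrDr mulrA (mulrA B B^-1) divff ?gt_eqF// mul1r.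
  lra.
have zz : `|z| ^+ 2 = \sum_(j <- F) inner (w j) (L j z).
  by rewrite -inner_synthesis -innerE.
have : 2 * `|z| ^+ 2 <= B * \sum_(j <- F) `|w j| ^+ 2 + `|z| ^+ 2.
  rewrite {1}zz mulr_sumr.
  apply: (@le_trans _ _ (\sum_(j <- F) (B * `|w j| ^+ 2 + B^-1 * `|L j z| ^+ 2))).
    by apply: ler_sum => j _.
  rewrite big_split/= -!mulr_sumr lerD2l.
  by rewrite ler_pdivrMl.
lra.
Qed.

(** Apply [synthesis_bound] to the tails of a square-summable family. *)
Lemma synthesis_cvg w (K : R) : (forall F, \sum_(j <- F) `|w j| ^+ 2 <= K) ->
  cvg (synthesis w @ totally).
Proof.
move=> wK; apply: cauchy_cvg; apply: cauchy_exP => e e0.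
have d0 : 0 < e ^+ 2 / B by rewrite divr_gt0// exprn_gt0.
have [F Ftail] := sum_fset_tail _ _ _ (fun j => sqr_ge0 `|w j|) wK d0.
exists (synthesis w F), F => //= G FG; rewrite -ball_normE/= distrC.
rewrite !partial_sumE (sum_fset_split _ _ _ FG) addrAC subrr add0r -partial_sumE.
rewrite -(ltr_pXn2r (n := 2)) ?nnegrE ?normr_ge0 ?ltW//.
apply: le_lt_trans (synthesis_bound _ _) _.
by rewrite mulrC -ltr_pdivlMr// Ftail.
Qed.

Lemma represents_bound w u (K : R) :
  (forall F, \sum_(j <- F) `|w j| ^+ 2 <= K) ->
  represents (fun j => adjoint (L j)) w u -> `|u| ^+ 2 <= B * K.
Proof.
move=> wK wu; apply: (@cvgr_to_le _ (@totally I) _ _ (fun F => `|synthesis w F| ^+ 2)).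
  by apply: cvgM; apply: cvg_norm.
apply: nearW => F; apply: le_trans (synthesis_bound _ _) _.
by rewrite ler_pM2l.
Qed.

Definition frame_operator (x : V) : V := lim (synthesis (L^~ x) @ totally).

Lemma represents_frame_operator x :
  represents (fun j => adjoint (L j)) (L^~ x) (frame_operator x).
Proof. exact: synthesis_cvg (bessel^~ x). Qed.

Lemma cvg_frame_operator x y :
  (fun F : {fset I} => \sum_(j <- F) inner (L j x) (L j y)) @ totally -->
    inner (frame_operator x) y.
Proof.
have -> : (fun F : {fset I} => \sum_(j <- F) inner (L j x) (L j y)) =
    (fun F => inner (synthesis (L^~ x) F) y).
  by apply/funext => F; rewrite inner_synthesis.
by apply: cvg_inner; [exact: represents_frame_operator|exact: cvg_cst].
Qed.

Lemma frame_operator_sym x y :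
  inner (frame_operator x) y = inner x (frame_operator y).
Proof.
rewrite (innerC x); apply: cvg_unique (cvg_frame_operator x y) _ => //.
have -> : (fun F : {fset I} => \sum_(j <- F) inner (L j x) (L j y)) =
    (fun F => \sum_(j <- F) inner (L j y) (L j x)).
  by apply/funext => F; apply: eq_bigr => j _; rewrite innerC.
exact: cvg_frame_operator.
Qed.

(** Linearity is immediate from symmetry, since [inner x (frame_operator z)] is
    linear in [x]. *)
Lemma frame_operator_bounded : bounded_operator frame_operator.
Proof.
split=> [a x y|].
  apply: inner_ext => z; rewrite innerDl innerZl !frame_operator_sym.
  by rewrite innerDl innerZl.
exists B => x.
rewrite -(ler_pXn2r (n := 2)) ?nnegrE ?mulr_ge0 ?(ltW B_gt0)// exprMn (expr2 B) -mulrA.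
exact: represents_bound (bessel^~ x) (represents_frame_operator x).
Qed.

(** [inner (frame_operator x) x] is the limit of a nondecreasing net. *)
Lemma sum_fset_le_frame_operator F x :
  \sum_(j <- F) `|L j x| ^+ 2 <= inner (frame_operator x) x.
Proof.
apply: cvgr_to_ge (cvg_frame_operator x x) _; exists F => // G FG /=.
under [leRHS]eq_bigr do rewrite innerE.
by apply: le_sum_fset => // j; exact: sqr_ge0.
Qed.

Variable A : R.
Hypothesis A_gt0 : 0 < A.
Hypothesis frame : forall x,
  ((A * `|x| ^+ 2)%:E <= \esum_(j in [set: I]) (`|L j x| ^+ 2)%:E)%E.

Lemma frame_operator_coercive x : A * `|x| ^+ 2 <= inner (frame_operator x) x.
Proof.
rewrite -lee_fin; apply: le_trans (frame x) _.
by apply: esum_le_sum_fset => F; exact: sum_fset_le_frame_operator.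
Qed.

(** The canonical dual frame coefficients: [L j v], where [v] is the preimage of
    [u] under the frame operator. *)
Lemma frame_representation u : exists2 v : V,
  represents (fun j => adjoint (L j)) (L^~ v) u &
  forall F, \sum_(j <- F) `|L j v| ^+ 2 <= A^-1 * `|u| ^+ 2.
Proof.
have [v Sv] : exists v, forall x, inner (frame_operator v) x = inner u x.
  apply: (coercive_solvable _ _ _ frame_operator_bounded frame_operator_sym A_gt0
    frame_operator_coercive).
  split; first by move=> a x y; rewrite innerDr innerZr.
  exists `|u| => x; rewrite ler_norml cauchy_schwarz andbT lerNl.
  by rewrite -mulN1r -innerZl scaleN1r -(normrN u) cauchy_schwarz.
have {}Sv : frame_operator v = u by exact: inner_ext.
exists v; first by rewrite -Sv; exact: represents_frame_operator.
move=> F; apply: le_trans (sum_fset_le_frame_operator F v) _.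
have := frame_operator_coercive v; have := cauchy_schwarz u v.
rewrite Sv; set q := inner u v => quv Aq.
have h : 0 <= (A * `|v| - `|u|) ^+ 2 by exact: sqr_ge0.
rewrite ler_pdivlMl//.
have := ler_wpM2l (ltW A_gt0) quv.
have := ler_wpM2l (ltW A_gt0) Aq.
nra.
Qed.

End bessel_families.

(** * Frames give stable splittings *)

Theorem mainTheorem4 (R : realType) (V : hilbertType R) (J : set int)
    (V_ : J -> hilbertType R) (b : forall j : J, {symmetric (V_ j)})
    (b_bounded : forall j : J, bounded_form (b j))
    (C1 C2 : R) (C1_gt0 : 0 < C1) (C2_gt0 : 0 < C2)
    (b_bounds : forall (j : J) (u : V_ j),
       C1 * `|u| ^+ 2 <= b j u u <= C2 * `|u| ^+ 2)
    (L : forall j : J, V -> V_ j) (L_gframe : gframe L) :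
  stable_space_splitting b (fun j : J => adjoint (L j)).
Proof.
have [L_bounded [A [B [A_gt0 B_gt0 AB]]]] := L_gframe.
have bessel (F : {fset J}) x : \sum_(j <- F) `|L j x| ^+ 2 <= B * `|x| ^+ 2.
  have /andP[_] := AB x; rewrite -lee_fin; apply: le_trans.
  exact: sum_fset_le_esum.
have frame x : ((A * `|x| ^+ 2)%:E <=
    \esum_(j in [set: J]) (`|L j x| ^+ 2)%:E)%E by case/andP: (AB x).
split=> // [j|j|].
- by exists C1 => // u; case/andP: (b_bounds j u).
- exact: adjoint_bounded.
exists (C1 / B), (C2 / A); split; [exact: divr_gt0|exact: divr_gt0|] => u.
apply/andP; split.
  apply: le_ereal_inf_tmp => _ [w wu <-].
  set E := esum _ _.
  have bE (F : {fset J}) : ((\sum_(j <- F) b j (w j) (w j))%:E <= E)%E.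
    exact: sum_fset_le_esum.
  case: E bE => [K bE| _|/(_ fset0)]; [|exact: leey|by []].
  rewrite lee_fin mulrAC ler_pdivrMr// -ler_pdivlMl// (mulrC K) mulrCA.
  apply: represents_bound wu => // F.
  rewrite ler_pdivlMl// mulr_sumr -lee_fin; apply: le_trans (bE F).
  by rewrite lee_fin; apply: ler_sum => j _; case/andP: (b_bounds j (w j)).
(* The infimum is at most the energy of one representation. *)
have [v vu vb] := frame_representation _ _ _ L_bounded B_gt0 bessel _ A_gt0 frame u.
apply: le_trans (_ : (\esum_(j in [set: J]) (b j (L j v) (L j v))%:E <= _)%E).
  by apply: ereal_inf_lbound; exists (L^~ v).
apply: esum_le_sum_fset => F.
rewrite -mulrA; apply: le_trans (_ : C2 * \sum_(j <- F) `|L j v| ^+ 2 <= _).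
  by rewrite mulr_sumr; apply: ler_sum => j _; case/andP: (b_bounds j (L j v)).
by rewrite ler_pM2l.
Qed.
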